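(* Let $f:(\mathbb{R}^2,0)\to(\mathbb{R}^3,0)$ be a map-germ such that $0$ is a cuspidal edge, let $\gamma(t)$ be a parametrization of the singular set $S(f)$, and $\hat\gamma(t)=f\circ\gamma(t)$. Let $\kappa(t)$ be the curvature of $\hat\gamma(t)$ as a curve in $\mathbb{R}^3$, $\kappa_s(t)$ its singular curvature and $\kappa_n(t)$ its limiting normal curvature. Then $$\kappa(t)^2=\kappa_s(t)^2+\kappa_n(t)^2.$$
   Context: All maps are $C^\infty$. A singular point of $f$ is a cuspidal edge if the germ of $f$ there becomes $(u,v)\mapsto(u,v^2,v^3)$ at $0$ after composing with diffeomorphism-germs of source and target. Near a cuspidal edge the singular set $S(f)$ is a regular curve consisting of cuspidal edges ($\gamma$ denotes a regular parametrization), $\ker df$ is one-dimensional along $S(f)$ and transverse to it, and there is a smooth unit normal vector field $\nu$ along $f$ ($\nu\perp\operatorname{Im}df$). Let $\lambda=\det(f_u,f_v,\nu)$, and let $\eta(t)$ be a smooth nonvanishing vector in $\ker df$ at $\gamma(t)$ such that $(\gamma'(t),\eta(t))$ is positively oriented. Then $$\kappa_s(t)=\operatorname{sgn}(d\lambda(\eta))\frac{\det(\hat\gamma'(t),\hat\gamma''(t),\nu(\gamma(t)))}{|\hat\gamma'(t)|^3},\qquad \kappa_\nu(t)=\frac{\langle\hat\gamma''(t),\nu(\gamma(t))\rangle}{|\hat\gamma'(t)|^2},\qquad\kappa_n(t)=|\kappa_\nu(t)|.$$ *)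

(* Defs.v *)
From HB Require Import structures.
From mathcomp Require Import all_boot all_order all_algebra.
From mathcomp Require Import all_classical all_reals all_analysis.

Set Implicit Arguments.
Unset Strict Implicit.
Unset Printing Implicit Defensive.

Import Order.TTheory GRing.Theory Num.Theory.
Import numFieldNormedType.Exports.

Local Open Scope classical_set_scope.
Local Open Scope ring_scope.

Section Smooth.
Context {R : realType}.

(* U is meant to be open. Since derivatives are taken in every direction v,
   [Ck_on k U f] says that all iterated partial derivatives of order <= k exist
   and are continuous on U. *)
Fixpoint Ck_on (V W : normedModType R) (k : nat) (U : set V) (f : V -> W)
    : Prop :=
  match k with
  | 0%N => forall x, U x -> {for x, continuous f}
  | k'.+1 => (forall x, U x -> differentiable f x) /\
             (forall v : V, Ck_on k' U ('D_v f))
  end.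

Definition smooth_on (V W : normedModType R) (U : set V) (f : V -> W) : Prop :=
  forall k, Ck_on k U f.

(* The neighbourhood is the same for all orders of differentiation. *)
Definition smooth_near (V W : normedModType R) (f : V -> W) (p : V) : Prop :=
  exists2 U : set V, open_nbhs p U & smooth_on U f.

(* Germs are represented by total functions whose values far from the base
   point are irrelevant. *)
Definition diffeo_germ (V W : normedModType R) (Phi : V -> W) (p : V) (q : W)
    : Prop :=
  [/\ smooth_near Phi p, Phi p = q &
      exists Psi : W -> V,
        [/\ smooth_near Psi q, Psi q = p,
            \forall x \near p, Psi (Phi x) = x &
            \forall y \near q, Phi (Psi y) = y]].

End Smooth.

Section Euclidean.
Context {R : realType}.

(* The library norm `|u| on matrices is the sup norm, hence [enorm]. *)
Definition dot n (u v : 'rV[R]_n) : R := \sum_i u 0 i * v 0 i.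
Definition enorm n (u : 'rV[R]_n) : R := Num.sqrt (dot u u).

Definition det2 (a b : 'rV[R]_2) : R :=
  \det (col_mx a b : 'M[R]_2).
Definition det3 (a b c : 'rV[R]_3) : R :=
  \det (col_mx a (col_mx b c) : 'M[R]_3).

(* |dT/ds|, with T the unit tangent and s the arc length. *)
Definition unit_tangent n (c : R -> 'rV[R]_n) (t : R) : 'rV[R]_n :=
  (enorm (derive1 c t))^-1 *: derive1 c t.
Definition curvature n (c : R -> 'rV[R]_n) (t : R) : R :=
  enorm (derive1 (unit_tangent c) t) / enorm (derive1 c t).

End Euclidean.

Section CuspidalEdge.
Context {R : realType}.
Implicit Types (f nu : 'rV[R]_2 -> 'rV[R]_3) (p : 'rV[R]_2).

Definition standard_cuspidal_edge (w : 'rV[R]_2) : 'rV[R]_3 :=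
  let u := w 0 0 in let v := w 0 1 in
  \row_(i < 3) [:: u; v ^+ 2; v ^+ 3]`_i.

Definition cuspidal_edge f p : Prop :=
  exists (phi : 'rV[R]_2 -> 'rV[R]_2) (Phi : 'rV[R]_3 -> 'rV[R]_3),
    [/\ diffeo_germ phi 0 p, diffeo_germ Phi (f p) 0 &
        \forall w \near (0 : 'rV[R]_2),
          Phi (f (phi w)) = standard_cuspidal_edge w].

Definition singular_set f : set 'rV[R]_2 := [set p | (\rank ('J f p) < 2)%N].

(* gamma restricted to some open interval around t0 parametrizes, regularly,
   the part of S lying in some neighbourhood of p = gamma t0. *)
Definition regular_parametrization_near (gamma : R -> 'rV[R]_2) (t0 : R)
    (S : set 'rV[R]_2) p : Prop :=
  gamma t0 = p /\
  exists (a b : R) (V : set 'rV[R]_2),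
    [/\ a < t0 < b /\ open_nbhs p V,
        smooth_on (V := R^o) `]a, b[ gamma,
        (forall t, a < t < b -> derive1 gamma t != 0) &
        gamma @` `]a, b[ = S `&` V].

Definition unit_normal_near f nu p : Prop :=
  smooth_near nu p /\
  \forall q \near p,
    enorm (nu q) = 1 /\ forall w : 'rV[R]_2, dot ('d f q w) (nu q) = 0.

Definition null_field_near f (gamma eta : R -> 'rV[R]_2) (t0 : R) : Prop :=
  smooth_near (V := R^o) eta t0 /\
  \forall t \near t0,
    [/\ eta t != 0, 'd f (gamma t) (eta t) = 0 &
        0 < det2 (derive1 gamma t) (eta t)].

(* delta_mx 0 0 and delta_mx 0 1 are the coordinate vectors d/du and d/dv. *)
Definition signed_area_density f nu (q : 'rV[R]_2) : R :=
  det3 ('D_(delta_mx 0 0) f q) ('D_(delta_mx 0 1) f q) (nu q).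

Definition singular_curvature f nu (gamma eta : R -> 'rV[R]_2) (t : R) : R :=
  let c := f \o gamma in
  Num.sg ('d (signed_area_density f nu : _ -> R^o) (gamma t) (eta t)) *
  (det3 (derive1 c t) (derive1n 2 c t) (nu (gamma t)) / enorm (derive1 c t) ^+ 3).

Definition normal_curvature f nu (gamma : R -> 'rV[R]_2) (t : R) : R :=
  let c := f \o gamma in
  dot (derive1n 2 c t) (nu (gamma t)) / enorm (derive1 c t) ^+ 2.

Definition limiting_normal_curvature f nu (gamma : R -> 'rV[R]_2) (t : R) : R :=
  `|normal_curvature f nu gamma t|.

End CuspidalEdge.

(* Main.v *)
(* Write a = c', b = c'' for c = f o gamma.  Since nu is a unit vector orthogonal
   to a, the Gram determinant of (a, b, nu) gives
     det(a, b, nu)^2 = |a|^2 |b|^2 - <a, b>^2 - |a|^2 <b, nu>^2,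
   and kappa^2 = (|a|^2 |b|^2 - <a, b>^2) / |a|^6; so the identity follows once
   sgn(d lambda(eta)) is known to be nonzero.  For that, write f near 0 as
   G o (u, v^2, v^3) o psi with psi and G local diffeomorphisms.  With y the second
   component of psi, the image of d f is spanned by X and y Y with X, Y independent
   and continuous, so that lambda = y * k, where k = det(d psi) det(X, Y, nu) is
   continuous, and nonzero where y = 0, since nu is then orthogonal to X and Y.
   A null vector eta forces y = 0 and d psi(eta) = (0, beta) with beta <> 0, hence
   d lambda(eta) = beta * k <> 0. *)
Require Import Defs.
From mathcomp Require Import all_boot all_order all_algebra.
From mathcomp Require Import all_classical all_reals all_analysis.
From mathcomp Require Import ring.
Import Order.TTheory GRing.Theory Num.Theory.
Import numFieldNormedType.Exports.
Local Open Scope classical_set_scope.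
Local Open Scope ring_scope.

Set Implicit Arguments.
Unset Strict Implicit.
Unset Printing Implicit Defensive.

(** * Small sums and determinants in coordinates *)

Lemma sum3E (V : nmodType) (F : 'I_3 -> V) : \sum_i F i = F 0 + F 1 + F 2.
Proof.
rewrite !big_ord_recl big_ord0 addr0 addrA.
by do ![congr (_ + _)]; congr F; apply/val_inj.
Qed.

Lemma sum2E (V : nmodType) (F : 'I_2 -> V) : \sum_i F i = F 0 + F 1.
Proof.
rewrite !big_ord_recl big_ord0 addr0.
by do ![congr (_ + _)]; congr F; apply/val_inj.
Qed.

Lemma det_mx33 (R : comPzRingType) (M : 'M[R]_3) :
  \det M =
    M 0 0 * (M 1 1 * M 2 2 - M 1 2 * M 2 1) -
    M 0 1 * (M 1 0 * M 2 2 - M 1 2 * M 2 0) +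
    M 0 2 * (M 1 0 * M 2 1 - M 1 1 * M 2 0).
Proof.
rewrite (expand_det_row _ 0) sum3E /cofactor.
rewrite !(expand_det_row _ 0) !sum2E /cofactor !det_mx11 !mxE.
have -> : lift (0 : 'I_2) (0 : 'I_1) = 1 by apply/val_inj.
have -> : lift (1 : 'I_2) (0 : 'I_1) = 0 by apply/val_inj.
have -> : lift (0 : 'I_3) (0 : 'I_2) = 1 by apply/val_inj.
have -> : lift (0 : 'I_3) (1 : 'I_2) = 2 by apply/val_inj.
have -> : lift (1 : 'I_3) (0 : 'I_2) = 0 by apply/val_inj.
have -> : lift (1 : 'I_3) (1 : 'I_2) = 2 by apply/val_inj.
have -> : lift (2 : 'I_3) (0 : 'I_2) = 0 by apply/val_inj.
have -> : lift (2 : 'I_3) (1 : 'I_2) = 1 by apply/val_inj.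
by rewrite /= !exprS !expr0; ring.
Qed.

(** * Inner products and triple products *)

Section Euclidean3.
Context {R : realType}.
Implicit Types a b c nu u v w : 'rV[R]_3.

Lemma dotE u v : dot u v = u 0 0 * v 0 0 + u 0 1 * v 0 1 + u 0 2 * v 0 2.
Proof. by rewrite /dot sum3E. Qed.

Lemma det3E a b c :
  det3 a b c =
    a 0 0 * (b 0 1 * c 0 2 - b 0 2 * c 0 1) -
    a 0 1 * (b 0 0 * c 0 2 - b 0 2 * c 0 0) +
    a 0 2 * (b 0 0 * c 0 1 - b 0 1 * c 0 0).
Proof.
pose M := (col_mx a (col_mx b c) : 'M[R]_3).
have M0 j : M 0 j = a 0 j.
  have -> : (0 : 'I_3) = lshift (1 + 1) (0 : 'I_1) by apply/val_inj.
  exact: col_mxEu.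
have M1 j : M 1 j = b 0 j.
  have -> : (1 : 'I_3) = rshift 1 (lshift 1 (0 : 'I_1)) by apply/val_inj.
  by rewrite [LHS]col_mxEd col_mxEu.
have M2 j : M 2 j = c 0 j.
  have -> : (2 : 'I_3) = rshift 1 (rshift 1 (0 : 'I_1)) by apply/val_inj.
  by rewrite [LHS]col_mxEd col_mxEd.
by rewrite /det3 -/M det_mx33 !M0 !M1 !M2.
Qed.

(** Meant for [a], [b] the fields [edge_field], [cross_field] and [k] the second component of psi:
    it pulls that component out of lambda, and the bracket becomes the Jacobian determinant of
    psi. *)
Lemma det3_lincomb a b nu (k x y z t : R) :
  det3 (x *: a + (k * y) *: b) (z *: a + (k * t) *: b) nu =
    k * ((x * t - y * z) * det3 a b nu).
Proof. by rewrite !det3E !mxE; ring. Qed.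

(* The Gram determinant of (a, b, nu) when nu is a unit vector orthogonal to a. *)
Lemma det3_normal_sqr a b nu : dot nu nu = 1 -> dot a nu = 0 ->
  det3 a b nu ^+ 2 =
    dot a a * dot b b - dot a b ^+ 2 - dot a a * dot b nu ^+ 2.
Proof.
move=> nn an.
transitivity (dot a a * dot b b * dot nu nu + 2 * dot a b * dot b nu * dot a nu
  - dot a a * dot b nu ^+ 2 - dot b b * dot a nu ^+ 2 - dot nu nu * dot a b ^+ 2).
  by rewrite det3E !dotE; ring.
by rewrite nn an; ring.
Qed.

Lemma dot_ge0 n (u : 'rV[R]_n) : 0 <= dot u u.
Proof. by apply: sumr_ge0 => i _; rewrite -expr2 sqr_ge0. Qed.

Lemma dot_eq0 n (u : 'rV[R]_n) : dot u u = 0 -> u = 0.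
Proof.
move=> /eqP; rewrite psumr_eq0 => [/allP uu|i _]; last by rewrite -expr2 sqr_ge0.
apply/rowP => i; have := uu i (mem_index_enum i).
by rewrite -expr2 sqrf_eq0 mxE => /eqP.
Qed.

Lemma enorm_sqr n (u : 'rV[R]_n) : enorm u ^+ 2 = dot u u.
Proof. by rewrite sqr_sqrtr ?dot_ge0. Qed.

Lemma dotDl n (u v w : 'rV[R]_n) : dot (u + v) w = dot u w + dot v w.
Proof. by rewrite -big_split; apply: eq_bigr => i _; rewrite mxE mulrDl. Qed.

Lemma dotZl n k (u v : 'rV[R]_n) : dot (k *: u) v = k * dot u v.
Proof. by rewrite mulr_sumr; apply: eq_bigr => i _; rewrite mxE mulrA. Qed.

Lemma dotC n (u v : 'rV[R]_n) : dot u v = dot v u.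
Proof. by apply: eq_bigr => i _; rewrite mulrC. Qed.

Lemma dot_sub_sqr n (x y : R) (u v : 'rV[R]_n) :
  dot (x *: v - y *: u) (x *: v - y *: u) =
    x ^+ 2 * dot v v - 2 * x * y * dot u v + y ^+ 2 * dot u u.
Proof.
rewrite -scaleNr dotDl !dotZl !(dotC _ (_ + _)) !dotDl !dotZl (dotC v u); ring.
Qed.

(** By the Gram identity the squared determinant is |a|^2 |b|^2 - <a, b>^2, so this is the equality
    case of Cauchy-Schwarz. *)
Lemma det3_normal_neq0 a b nu : dot nu nu = 1 -> dot a nu = 0 -> dot b nu = 0 ->
  (forall x y, x *: a + y *: b = 0 -> x = 0 /\ y = 0) -> det3 a b nu != 0.
Proof.
move=> nn an bn free; rewrite -sqrf_eq0 det3_normal_sqr// bn expr0n/= mulr0 subr0.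
apply/eqP => gram.
(* This vector has squared length |a|^2 (|a|^2 |b|^2 - <a, b>^2), hence is 0. Freeness then gives
   <a, a> = 0, and a = 0 contradicts freeness with coefficients 1 and 0. *)
have /free[] : (- dot a b) *: a + dot a a *: b = 0.
  apply: dot_eq0; rewrite !dotDl !dotZl ![dot _ (_ + _)]dotC !dotDl !dotZl.
  rewrite (dotC b a).
  transitivity (dot a a * (dot a a * dot b b - dot a b ^+ 2)); first by ring.
  by rewrite gram mulr0.
move=> _ /dot_eq0 a0.
have [] := free 1 0; first by rewrite a0 !scaler0 scale0r add0r.
by move=> /eqP; rewrite oner_eq0.
Qed.

End Euclidean3.

(** * Directional derivatives of matrix-valued maps, and the curvature of a curve *)

Section Calculus.
Context {R : realType}.

Lemma is_derive_coord (V : normedModType R) m n (M : V -> 'M[R]_(m, n)) x v dM i j :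
  is_derive x v M dM -> is_derive x v (fun y => M y i j) (dM i j).
Proof.
move=> [Mxv <-]; split; first exact: (derivable_mxP _ _ _).1.
by rewrite (derive_mx Mxv) mxE.
Qed.

Lemma is_derive_mx (V : normedModType R) m n (M : V -> 'M[R]_(m, n)) x v
    (dM : 'M[R]_(m, n)) :
  (forall i j, is_derive x v (fun y => M y i j) (dM i j)) -> is_derive x v M dM.
Proof.
move=> dMij.
have Mxv : derivable M x v by apply/derivable_mxP => i j; case: (dMij i j).
split=> //; rewrite derive_mx//; apply/matrixP => i j; rewrite mxE.
exact: derive_val.
Qed.

Lemma is_derive_dot (V : normedModType R) n (a b : V -> 'rV[R]_n) x v da db :
  is_derive x v a da -> is_derive x v b db ->
  is_derive x v (fun y => dot (a y) (b y)) (dot da (b x) + dot (a x) db).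
Proof.
move=> a' b'; rewrite /dot -big_split/=.
have -> : (fun y => \sum_i a y 0 i * b y 0 i) =
    \sum_i (fun y => a y 0 i * b y 0 i) by apply/funext => y; rewrite fct_sumE.
apply: is_derive_sum => i.
have ai := is_derive_coord 0 i a'; have bi := is_derive_coord 0 i b'.
apply: is_derive_eq (is_deriveM ai bi) _.
by rewrite /GRing.scale/= addrC (mulrC (b x 0 i)).
Qed.

(** With N = |a|, the derivative of the unit tangent is b / N - (<a, b> / N^3) a, the part of b
    orthogonal to a divided by N. *)
Lemma curvature_sqr n (c : R -> 'rV[R]_n) t : derivable (derive1 c) t 1 ->
  let a := derive1 c t in let b := derive1n 2 c t in
  curvature c t ^+ 2 = (dot a a * dot b b - dot a b ^+ 2) / dot a a ^+ 3.
Proof.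
move=> /derivableP; rewrite -derive1E => c' a b.
rewrite /curvature expr_div_n 2!enorm_sqr.
(* At a stationary point both sides are 0, because division by 0 yields 0. *)
have [a0|a0] := eqVneq (dot a a) 0; first by rewrite a0 expr0n/= !invr0 !mulr0.
have aa_gt0 : 0 < dot a a by rewrite lt_neqAle eq_sym a0 dot_ge0.
have N_gt0 : 0 < enorm a by rewrite sqrtr_gt0.
have N0 : enorm a != 0 by rewrite gt_eqF.
have N' : is_derive t 1 (fun s => enorm (derive1 c s)) (dot a b / enorm a).
  have dd := is_derive_dot c' c'.
  apply: is_derive_eq (is_derive1_comp (is_derive1_sqrt aa_gt0) dd) _.
  by rewrite -/(enorm a) (dotC _ a); field.
have T' : is_derive t 1 (unit_tangent c)
    ((enorm a)^-1 *: b - (dot a b / enorm a ^+ 3) *: a).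
  apply: is_derive_mx => i j.
  have -> : (fun s => unit_tangent c s i j) =
      (fun s => (enorm (derive1 c s))^-1) * (fun s => derive1 c s i j).
    by apply/funext => s; rewrite mxE.
  have NV := @is_deriveV _ (fun s => enorm (derive1 c s)) t _ 1 N0 N'.
  apply: is_derive_eq (is_deriveM NV (is_derive_coord i j c')) _.
  by rewrite !mxE /GRing.scale/= -/a -/b; field.
rewrite derive1E (derive_val (is_derive := T')) dot_sub_sqr.
rewrite -/a -[dot a a]enorm_sqr; move: (enorm a) (dot a b) (dot b b) N0 => N p q N0.
by field.
Qed.

End Calculus.

(** * Consequences of smoothness: inverse germs, continuity, second derivatives *)

Section Smooth.
Context {R : realType}.

(** Smoothness enters the argument in this second-order form, which holds at all points near [p] and
    so can be moved to nearby base points. *)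
Lemma smooth_near_diff (V W : normedModType R) (f : V -> W) p :
  smooth_near f p ->
  \forall q \near p, differentiable f q /\ forall v, differentiable ('D_v f) q.
Proof.
move=> [U Up fU]; near=> q.
have Uq : U q by near: q; exact: open_nbhs_nbhs.
have [df d2f] := fU 2; split; first exact: df.
by move=> v; have [+ _] := d2f v; apply.
Unshelve. all: by end_near. Qed.

(** Chain rule for [G \o F], whose germ at [x] is that of the identity. *)
Lemma diff_left_inverse (V W : normedModType R) (F : V -> W) (G : W -> V) x :
  differentiable F x -> differentiable G (F x) ->
  (\forall y \near x, G (F y) = y) ->
  forall v, 'd G (F x) ('d F x v) = v.
Proof.
move=> dF dG GF v.
transitivity ('d (G \o F) x v); first by rewrite [in RHS]diff_comp.
rewrite -deriveE; last exact: differentiable_comp.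
by rewrite (@near_eq_derive _ _ _ (G \o F) id x v GF) derive_id.
Qed.

Lemma diff_left_inverse_eq0 (V W : normedModType R) (F : V -> W) (G : W -> V) x v :
  differentiable F x -> differentiable G (F x) ->
  (\forall y \near x, G (F y) = y) -> 'd F x v = 0 -> v = 0.
Proof.
move=> dF dG GF v0; rewrite -[LHS](diff_left_inverse dF dG GF) v0.
exact: linear0.
Qed.

(* Unlike in the Leibniz rule, [m] need not be derivable. *)
Lemma derive_mul_zero (V : normedModType R) (y m : V -> R) x v b :
  y x = 0 -> is_derive x v y b -> {for x, continuous m} ->
  is_derive x v (y * m) (b * m x).
Proof.
move=> yx0 [dy <-] cm.
have line : (h *: v + x) @[h --> 0^'] --> x.
  rewrite -[X in _ --> X]add0r -[X in _ --> X + _](scale0r v).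
  apply: cvgD; last exact: cvg_cst.
  by apply: cvgZr_tmp; exact: nbhs_dnbhs.
have quot : h^-1 *: ((y * m) (h *: v + x) - (y * m) x) @[h --> 0^'] -->
    'D_v y x * m x.
  (* As [y x = 0], the difference quotient of the product is that of [y] times [m] at the shifted
     point, so only continuity of [m] is called for. *)
  rewrite (_ : (fun h => _) = (fun h => h^-1 *: (y (h *: v + x) - y x)) *
      (m \o (fun h => h *: v + x))); last first.
    apply/funext => h; rewrite /GRing.scale/= -![(_ * _ : _ -> _) _]/(_ * _)/=.
    by rewrite yx0 mul0r !subr0 mulrA.
  by apply: cvgM; [exact: dy | exact: cvg_comp line cm].
by split; [apply/cvg_ex; eexists; exact: quot | exact: cvg_lim quot].
Qed.

Lemma continuous_coord (T : topologicalType) m n (M : T -> 'M[R]_(m, n)) x i j :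
  {for x, continuous M} -> {for x, continuous (fun y => M y i j)}.
Proof.
move=> cM; apply: (@continuous_comp _ _ _ M (fun N => N i j)) => //.
exact: coord_continuous.
Qed.

Lemma continuous_dot (T : topologicalType) (a b : T -> 'rV[R]_3) x :
  {for x, continuous a} -> {for x, continuous b} ->
  {for x, continuous (fun y => dot (a y) (b y))}.
Proof.
move=> ca cb; rewrite (funext (fun y => dotE (a y) (b y))).
have cM (g h : T -> R) : {for x, continuous g} -> {for x, continuous h} ->
    {for x, continuous (fun y => g y * h y)} by exact: continuousM.
have cD (g h : T -> R) : {for x, continuous g} -> {for x, continuous h} ->
    {for x, continuous (fun y => g y + h y)} by exact: continuousD.
by apply/cD; [apply/cD|]; apply/cM; apply: continuous_coord.
Qed.

Lemma continuous_det3 (T : topologicalType) (a b c : T -> 'rV[R]_3) x :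
  {for x, continuous a} -> {for x, continuous b} -> {for x, continuous c} ->
  {for x, continuous (fun y => det3 (a y) (b y) (c y))}.
Proof.
move=> ca cb cc.
rewrite (funext (fun y => det3E (a y) (b y) (c y))).
have cM (g h : T -> R) : {for x, continuous g} -> {for x, continuous h} ->
    {for x, continuous (fun y => g y * h y)} by exact: continuousM.
have cD (g h : T -> R) : {for x, continuous g} -> {for x, continuous h} ->
    {for x, continuous (fun y => g y + h y)} by exact: continuousD.
have cB (g h : T -> R) : {for x, continuous g} -> {for x, continuous h} ->
    {for x, continuous (fun y => g y - h y)} by exact: continuousB.
by apply/cD; [apply/cB|]; (apply/cM; [|apply/cB; apply/cM]);
  apply: continuous_coord.
Qed.

Lemma differentiable_det3 (V : normedModType R) (a b c : V -> 'rV[R]_3) x :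
  differentiable a x -> differentiable b x -> differentiable c x ->
  differentiable (fun y => det3 (a y) (b y) (c y)) x.
Proof.
have dcoord (d : V -> 'rV[R]_3) i : differentiable d x ->
    differentiable (fun y => d y 0 i : R) x.
  by move=> dd; apply: differentiable_comp dd (differentiable_coord _ _ _).
move=> da db dc.
rewrite (funext (fun y => det3E (a y) (b y) (c y))).
have dM (g h : V -> R) : differentiable g x -> differentiable h x ->
    differentiable (fun y => g y * h y) x by exact: differentiableM.
have dD (g h : V -> R) : differentiable g x -> differentiable h x ->
    differentiable (fun y => g y + h y) x by exact: differentiableD.
have dB (g h : V -> R) : differentiable g x -> differentiable h x ->
    differentiable (fun y => g y - h y) x by exact: differentiableB.
by apply/dD; [apply/dB|]; (apply/dM; [|apply/dB; apply/dM]); apply: dcoord.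
Qed.

(** Supplies the second derivative of f o gamma that [curvature_sqr] asks for, and shows that its
    velocity lies in the image of df, hence is orthogonal to nu. *)
Lemma derivable_derive1_comp (f : 'rV[R]_2 -> 'rV[R]_3) (g : R -> 'rV[R]_2) t :
  (\forall q \near g t, differentiable f q) ->
  (forall v, differentiable ('D_v f) (g t)) ->
  (\forall s \near t, derivable g s 1) -> derivable (derive1 g) t 1 ->
  derivable (derive1 (f \o g)) t 1 /\
  derive1 (f \o g) t = 'd f (g t) (derive1 g t).
Proof.
move=> df d2f dg d2g.
have g_cvg : g s @[s --> t] --> g t.
  have /derivable1_diffP := nbhs_singleton dg.
  exact: differentiable_continuous.
have fg' : \forall s \near t,
    derive1 (f \o g) s = 'd f (g s) (derive1 g s).
  near=> s; have /derivable1_diffP dgs : derivable g s 1 by near: s.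
  have dfs : differentiable f (g s) by near: s; exact: (g_cvg _ df).
  rewrite (derive1E' (differentiable_comp dgs dfs)) (derive1E' dgs).
  by rewrite (diff_comp dgs dfs).
split; last exact: nbhs_singleton fg'.
(* Both the differential of [f] and its argument vary with [s]. Expanding in partial derivatives
   turns the velocity into a sum of products of derivable factors. *)
apply: (near_eq_derivable (f := fun s =>
  \sum_(i < 2) derive1 g s 0 i *: 'D_(delta_mx 0 i) f (g s))).
  near=> s; have -> : derive1 (f \o g) s = 'd f (g s) (derive1 g s) by near: s.
  have dfs : differentiable f (g s) by near: s; exact: (g_cvg _ df).
  rewrite [X in 'd f _ X]row_sum_delta linear_sum; apply: eq_bigr => i _.
  by rewrite linearZ deriveE.
apply/derivable_mxP => i j.
rewrite (_ : (fun s => _) = \sum_(k < 2)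
    (fun s => derive1 g s 0 k * ('D_(delta_mx 0 k) f \o g) s i j)); last first.
  apply/funext => s; rewrite fct_sumE summxE.
  by apply: eq_bigr => k _; rewrite mxE.
apply: derivable_sum => k; apply: derivableM; first exact: (derivable_mxP _ _ _).1.
apply: (derivable_mxP _ _ _).1; apply/derivable1_diffP.
apply: differentiable_comp (d2f _).
by have /derivable1_diffP := nbhs_singleton dg.
Unshelve. all: by end_near. Qed.

End Smooth.

(** * The standard cuspidal edge and the factorization of f through it *)

Section CuspidalEdge.
Context {R : realType}.
Local Notation cusp := (@standard_cuspidal_edge R).

Lemma differentiable_standard_cuspidal_edge w : differentiable cusp w.
Proof.
have -> : cusp = (fun w : 'rV[R]_2 => w 0 0 *: delta_mx 0 0 +
    w 0 1 ^+ 2 *: delta_mx 0 1 + w 0 1 ^+ 3 *: delta_mx 0 2).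
  apply/funext => z; apply/rowP => -[[|[|[|//]]] i];
  by rewrite !mxE/= ?(mulr0, mulr1, addr0, add0r).
have dX n : differentiable (fun z : 'rV[R]_2 => z 0 1 ^+ n.+1 : R) w.
  rewrite (_ : (fun _ => _) = (fun z : 'rV[R]_2 => z 0 1 : R) ^+ n.+1).
    by apply: differentiableX; exact: differentiable_coord.
  by apply/funext => z; rewrite exprfctE.
apply: differentiableD; [apply: differentiableD|]; apply: differentiableZl.
- exact: differentiable_coord.
- exact: dX.
- exact: dX.
Qed.

(** The second partial derivative (0, 2 y, 3 y^2), with y = [w 0 1], is written as y times (0, 2, 3
    y): the remaining vector stays independent of (1, 0, 0) even where y = 0. *)
Lemma diff_standard_cuspidal_edge w v :
  'd cusp w v = v 0 0 *: delta_mx 0 0 +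
    (w 0 1 * v 0 1) *: (2 *: delta_mx 0 1 + (3 * w 0 1) *: delta_mx 0 2).
Proof.
have dw := differentiable_standard_cuspidal_edge w.
have coord i : is_derive w v (fun z : 'rV[R]_2 => z 0 i) (v 0 i).
  exact: is_derive_coord (is_derive_id w v).
rewrite -deriveE//; apply: derive_val; apply: is_derive_mx => i.
rewrite (ord1 i) {i} => -[[|[|[|//]]] j];
  rewrite !mxE/= ?(mulr0, mulr1, addr0, add0r).
- rewrite (_ : (fun y => cusp y 0 _) = (fun z => z 0 0))//.
  by apply/funext => z; rewrite !mxE.
- rewrite (_ : (fun y => cusp y 0 _) = (fun z => z 0 1) ^+ 2).
    by apply: is_derive_eq (is_deriveX 2 (coord 1)) _; rewrite /GRing.scale/=; ring.
  by apply/funext => z; rewrite !mxE.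
- rewrite (_ : (fun y => cusp y 0 _) = (fun z => z 0 1) ^+ 3).
    by apply: is_derive_eq (is_deriveX 3 (coord 1)) _; rewrite /GRing.scale/=; ring.
  by apply/funext => z; rewrite !mxE.
Qed.

(** A condition at a single point, so that it can be quantified with [\near]. Local invertibility of
    [psi] and [G] is recorded through their differentials. *)
Definition cuspidal_factorization (psi : 'rV[R]_2 -> 'rV[R]_2)
    (G : 'rV[R]_3 -> 'rV[R]_3) (f : 'rV[R]_2 -> 'rV[R]_3) q : Prop :=
  [/\ f q = G (cusp (psi q)),
      differentiable psi q /\ (forall v, differentiable ('D_v psi) q),
      differentiable G (cusp (psi q)) /\
        (forall v, differentiable ('D_v G) (cusp (psi q))),
      (forall v, 'd psi q v = 0 -> v = 0) /\ (forall w, exists v, 'd psi q v = w) &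
      forall v, 'd G (cusp (psi q)) v = 0 -> v = 0].

(** Take for [psi] and [G] the inverse germs of [phi] and [Phi], and solve the normal form for [f].
    Continuity of [f] keeps [f q] where [G] inverts [Phi]. *)
Lemma cuspidal_edge_factorization f p :
  {for p, continuous f} -> cuspidal_edge f p ->
  exists psi G, \forall q \near p, cuspidal_factorization psi G f q.
Proof.
move=> cf [phi [Phi [[phi_smooth phi0 [psi [psi_smooth psip psiphi phipsi]]]
  [Phi_smooth Phifp [G [G_smooth G0 GPhi PhiG]]] normal]]].
exists psi, G.
have cont (V W : normedModType R) (h : V -> W) x y :
    smooth_near h x -> h x = y -> h z @[z --> x] --> y.
  move=> /smooth_near_diff/nbhs_singleton[dh _] <-.
  exact: differentiable_continuous.
(* Through these limits, conditions holding near 0 in the model or near [f p] become conditions on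
   [q] near [p]. *)
have cpsi := cont _ _ _ _ _ psi_smooth psip.
have cG := cont _ _ _ _ _ G_smooth G0.
have ccusp : cusp z @[z --> (0 : 'rV[R]_2)] --> (0 : 'rV[R]_3).
  have cusp0 : cusp 0 = 0.
    by apply/rowP => -[[|[|[|//]]] i]; rewrite !mxE/= ?expr0n.
  rewrite -[X in _ --> X]cusp0.
  exact/differentiable_continuous/differentiable_standard_cuspidal_edge.
have ccp : cusp (psi q) @[q --> p] --> (0 : 'rV[R]_3) by exact: cvg_comp cpsi ccusp.
have cfp : f q @[q --> p] --> f p := cf.
near=> q; split.
- have <- : G (Phi (f q)) = f q by near: q; exact: (cfp _ GPhi).
  have <- : Phi (f (phi (psi q))) = cusp (psi q) by near: q; exact: (cpsi _ normal).
  by have -> : phi (psi q) = q by near: q.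
- by near: q; exact: (smooth_near_diff psi_smooth).
- by near: q; exact: (ccp _ (smooth_near_diff G_smooth)).
- have [dpsi _] : differentiable psi q /\ forall v, differentiable ('D_v psi) q.
    by near: q; exact: (smooth_near_diff psi_smooth).
  have [dphi _] : differentiable phi (psi q) /\
      forall v, differentiable ('D_v phi) (psi q).
    by near: q; exact: (cpsi _ (smooth_near_diff phi_smooth)).
  (* To be differentiated at [q], the inverse relations must hold on a neighbourhood of [q], not
     only at [q]; [near_join] provides this. *)
  have phipsiq : \forall y \near q, phi (psi y) = y.
    by near: q; exact: (near_join phipsi).
  have psiphiq : \forall y \near psi q, psi (phi y) = y.
    by near: q; exact: (cpsi _ (near_join psiphi)).
  have qE : phi (psi q) = q by exact: nbhs_singleton phipsiq.
  split=> [v v0|w].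
    exact: (diff_left_inverse_eq0 dpsi dphi phipsiq v0).
  (* The differentials of [psi] and [phi] are inverse to each other, so the preimage of [w] is its
     image under that of [phi]. *)
  exists ('d phi (psi q) w); rewrite -[X in 'd psi X]qE.
  by apply: diff_left_inverse => //; rewrite qE.
- have [dG _] : differentiable G (cusp (psi q)) /\
      forall v, differentiable ('D_v G) (cusp (psi q)).
    by near: q; exact: (ccp _ (smooth_near_diff G_smooth)).
  have [dPhi _] : differentiable Phi (G (cusp (psi q))) /\
      forall v, differentiable ('D_v Phi) (G (cusp (psi q))).
    by near: q; exact: (ccp _ (cG _ (smooth_near_diff Phi_smooth))).
  have PhiGq : \forall y \near cusp (psi q), Phi (G y) = y.
    by near: q; exact: (ccp _ (near_join PhiG)).
  by move=> v; exact: (diff_left_inverse_eq0 dG dPhi PhiGq).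
Unshelve. all: by end_near. Qed.

End CuspidalEdge.

(** * The derivative of lambda in a null direction *)

Section SignedAreaDensity.
Context {R : realType}.
Variables (psi : 'rV[R]_2 -> 'rV[R]_2) (G : 'rV[R]_3 -> 'rV[R]_3).
Variables f nu : 'rV[R]_2 -> 'rV[R]_3.
Local Notation cusp := (@standard_cuspidal_edge R).
Local Notation y := (fun q => psi q 0 1).

(* The image under [dG] of the second partial derivative [(0, 2 y, 3 y^2)] of
   the standard cuspidal edge is [y] times [cross_field]. *)
Definition edge_field q : 'rV[R]_3 := 'D_(delta_mx 0 0) G (cusp (psi q)).
Definition cross_field q : 'rV[R]_3 :=
  2 *: 'D_(delta_mx 0 1) G (cusp (psi q)) +
  (3 * psi q 0 1) *: 'D_(delta_mx 0 2) G (cusp (psi q)).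

(** Chain rule through [psi], [cusp] and [G]; the factor [psi q 0 1] inherited from [cusp] is what
    makes df drop rank. *)
Lemma diff_cuspidal_factorization q v :
  (\forall z \near q, cuspidal_factorization psi G f z) -> differentiable f q ->
  'd f q v = ('d psi q v) 0 0 *: edge_field q +
             (psi q 0 1 * ('d psi q v) 0 1) *: cross_field q.
Proof.
move=> fact df; have [_ [dpsi _] [dG _] _ _] := nbhs_singleton fact.
have dcp : differentiable (cusp \o psi) q.
  exact: differentiable_comp dpsi (differentiable_standard_cuspidal_edge _).
rewrite -deriveE// (@near_eq_derive _ _ _ f (G \o (cusp \o psi))); last first.
  by near=> z; have [] : cuspidal_factorization psi G f z by near: z.
rewrite deriveE; last exact: differentiable_comp.
rewrite (diff_comp dcp dG)/=.
rewrite (diff_comp dpsi (differentiable_standard_cuspidal_edge _))/=.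
rewrite diff_standard_cuspidal_edge linearD !linearZ linearD !linearZ/=.
by rewrite -!deriveE.
Unshelve. all: by end_near. Qed.

(** The two fields are images of (1, 0, 0) and (0, 2, 3 y) under the injective differential of
    [G]. *)
Lemma free_edge_cross q : cuspidal_factorization psi G f q ->
  forall a b, a *: edge_field q + b *: cross_field q = 0 -> a = 0 /\ b = 0.
Proof.
move=> [_ _ [dG _] _ injG] a b.
rewrite /edge_field /cross_field !deriveE// -!linearZ -linearD -linearZ -linearD.
move=> /injG ab; split.
  by have := congr1 (fun u : 'rV[R]_3 => u 0 0) ab; rewrite !mxE/= => <-; ring.
have := congr1 (fun u : 'rV[R]_3 => u 0 1) ab; rewrite !mxE/=.
rewrite !(mulr0, mulr1, addr0, add0r) => /eqP.
by rewrite mulf_eq0 pnatr_eq0 orbF => /eqP.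
Qed.

(** If v and w are preimages of the two basis vectors, det(v, w) times the Jacobian determinant is
    the determinant of the identity, that is 1. *)
Lemma det_cuspidal_factorization q : cuspidal_factorization psi G f q ->
  'd psi q (delta_mx 0 0) 0 0 * 'd psi q (delta_mx 0 1) 0 1 -
  'd psi q (delta_mx 0 0) 0 1 * 'd psi q (delta_mx 0 1) 0 0 != 0.
Proof.
move=> [_ _ _ [_ surj] _].
have lin v : 'd psi q v = v 0 0 *: 'd psi q (delta_mx 0 0) +
    v 0 1 *: 'd psi q (delta_mx 0 1).
  rewrite -!linearZ -linearD; congr ('d psi q _).
  by rewrite {1}[v]row_sum_delta sum2E.
have [v] := surj (delta_mx 0 0); have [w] := surj (delta_mx 0 1).
rewrite (lin v) (lin w).
set a := 'd psi q _; set b := 'd psi q _ => wE vE.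
have w0 := congr1 (fun u : 'rV[R]_2 => u 0 0) wE.
have w1 := congr1 (fun u : 'rV[R]_2 => u 0 1) wE.
have v0 := congr1 (fun u : 'rV[R]_2 => u 0 0) vE.
have v1 := congr1 (fun u : 'rV[R]_2 => u 0 1) vE.
move: w0 w1 v0 v1; rewrite !mxE/= => w0 w1 v0 v1.
apply/eqP => ab; suff /eqP : (1 : R) = 0 by rewrite oner_eq0.
transitivity ((v 0 0 * w 0 1 - v 0 1 * w 0 0) * (a 0 0 * b 0 1 - a 0 1 * b 0 0)).
  transitivity ((v 0 0 * a 0 0 + v 0 1 * b 0 0) * (w 0 0 * a 0 1 + w 0 1 * b 0 1)
    - (v 0 0 * a 0 1 + v 0 1 * b 0 1) * (w 0 0 * a 0 0 + w 0 1 * b 0 0)).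
    by rewrite w0 w1 v0 v1; ring.
  by ring.
by rewrite ab mulr0.
Qed.

Lemma diff_signed_area_density_neq0 q0 eta :
  (\forall q \near q0, cuspidal_factorization psi G f q) ->
  (\forall q \near q0, differentiable f q) ->
  (forall v, differentiable ('D_v f) q0) -> differentiable nu q0 ->
  (\forall q \near q0, enorm (nu q) = 1 /\ forall w, dot ('d f q w) (nu q) = 0) ->
  eta != 0 -> 'd f q0 eta = 0 ->
  'd (signed_area_density f nu : _ -> R^o) q0 eta != 0.
Proof.
move=> fact df d2f dnu normal eta0 feta.
have fact0 := nbhs_singleton fact; have df0 := nbhs_singleton df.
have [_ [dpsi d2psi] [dG d2G] [injpsi _] _] := fact0.
have dpsiC : {for q0, continuous psi} by exact: differentiable_continuous.
have cnu : {for q0, continuous nu} by exact: differentiable_continuous.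
have yC : {for q0, continuous y} by exact: continuous_coord.
have DGC v : {for q0, continuous (fun q => 'D_v G (cusp (psi q)))}.
  apply: (@continuous_comp _ _ _ (cusp \o psi) ('D_v G)).
    apply: continuous_comp => //; apply: differentiable_continuous.
    exact: differentiable_standard_cuspidal_edge.
  exact/differentiable_continuous/d2G.
have edgeC : {for q0, continuous edge_field} by exact: DGC.
have crossC : {for q0, continuous cross_field}.
  have y3C : {for q0, continuous (fun q => 3 * y q)}.
    apply: (@continuousM _ _ (cst 3) y); last exact: yC.
    exact: cst_continuous.
  have DG2 : {for q0, continuous (fun q =>
      2 *: 'D_(delta_mx 0 1) G (cusp (psi q)))}.
    exact: (continuousZl_tmp (DGC (delta_mx 0 1))).
  have DG3 : {for q0, continuous (fun q =>
      (3 * y q) *: 'D_(delta_mx 0 2) G (cusp (psi q)))}.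
    exact: (continuousZ y3C (DGC (delta_mx 0 2))).
  exact: continuousD DG2 DG3.
have [y0 etay] : y q0 = 0 /\ 'd psi q0 eta 0 1 != 0.
  move: feta; rewrite diff_cuspidal_factorization//.
  move=> /(free_edge_cross fact0)[e0 /eqP]; rewrite mulf_eq0.
  (* The first component of d psi(eta) is already 0; if the second were too, injectivity would give
     eta = 0. *)
  have e1 : 'd psi q0 eta 0 1 != 0.
    apply: contra_neq eta0 => e1; apply: injpsi; apply/rowP => -[[|[|//]] i].
      by rewrite mxE -e0; congr ('d psi q0 eta _ _); apply/val_inj.
    by rewrite mxE -e1; congr ('d psi q0 eta _ _); apply/val_inj.
  by rewrite (negPf e1) orbF => /eqP.
have y' : is_derive q0 eta y ('d psi q0 eta 0 1).
  apply: is_derive_coord; rewrite -deriveE//.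
  exact/derivableP/diff_derivable.
(* Test normality against preimages under d psi of the two basis vectors. *)
have near_nu : \forall q \near q0,
    dot (edge_field q) (nu q) = 0 /\ y q * dot (cross_field q) (nu q) = 0.
  near=> q.
  have factq : \forall z \near q, cuspidal_factorization psi G f z.
    by near: q; exact: (near_join fact).
  have dfq : differentiable f q by near: q.
  have [_ fnu] : enorm (nu q) = 1 /\ forall w, dot ('d f q w) (nu q) = 0.
    by near: q.
  have [_ _ _ [_ surj] _] := nbhs_singleton factq.
  have [v vE] := surj (delta_mx 0 0); have [w wE] := surj (delta_mx 0 1).
  have := fnu v; have := fnu w; rewrite !diff_cuspidal_factorization// vE wE.
  rewrite !mxE/= !(scale0r, mulr0, mulr1, scale1r, addr0, add0r).
  by rewrite dotZl.
(* At [q0] the relation y <Y, nu> = 0 is empty since y = 0. Holding near [q0], it can be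
   differentiated along [eta], which gives beta <Y, nu> = 0 with beta nonzero. *)
have cross_nu : dot (cross_field q0) (nu q0) = 0.
  have yd := derive_mul_zero y0 y' (continuous_dot crossC cnu).
  have /eqP : 'd psi q0 eta 0 1 * dot (cross_field q0) (nu q0) = 0.
    have <- := derive_val (is_derive := yd).
    rewrite (@near_eq_derive _ _ _ _ (cst 0)) ?derive_cst//.
    by near=> q; have [] : dot (edge_field q) (nu q) = 0 /\
      y q * dot (cross_field q) (nu q) = 0 by near: q.
  by rewrite mulf_eq0 (negPf etay) => /eqP.
have det_neq0 : det3 (edge_field q0) (cross_field q0) (nu q0) != 0.
  have [nu1 _] := nbhs_singleton normal.
  apply: det3_normal_neq0 => //; last exact: free_edge_cross.
    by rewrite -enorm_sqr nu1 expr1n.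
  by have [] := nbhs_singleton near_nu.
(* The Jacobian determinant of [psi], written with directional derivatives because their continuity
   in [q] is known. *)
pose J q := 'D_(delta_mx 0 0) psi q 0 0 * 'D_(delta_mx 0 1) psi q 0 1 -
  'D_(delta_mx 0 0) psi q 0 1 * 'D_(delta_mx 0 1) psi q 0 0.
have J0 : J q0 != 0.
  by rewrite /J !deriveE//; exact: det_cuspidal_factorization fact0.
have JC : {for q0, continuous J}.
  have cP i j k l : {for q0, continuous (fun q : 'rV[R]_2 =>
      'D_(delta_mx 0 i) psi q 0 j * 'D_(delta_mx 0 k) psi q 0 l)}.
    by apply: (@continuousM _ _ (fun q => 'D_(delta_mx 0 i) psi q 0 j));
      apply: continuous_coord; exact/differentiable_continuous/d2psi.
  exact: (continuousB (cP 0 0 1 1) (cP 0 1 1 0)).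
pose K q := J q * det3 (edge_field q) (cross_field q) (nu q).
have KC : {for q0, continuous K}.
  exact: (continuousM JC (continuous_det3 edgeC crossC cnu)).
have lambdaE : \forall q \near q0, signed_area_density f nu q = y q * K q.
  near=> q.
  have factq : \forall z \near q, cuspidal_factorization psi G f z.
    by near: q; exact: (near_join fact).
  have dfq : differentiable f q by near: q.
  have [_ [dpsiq _] _ _ _] := nbhs_singleton factq.
  rewrite /signed_area_density /K /J !(@deriveE _ _ _ f)//.
  rewrite !diff_cuspidal_factorization// !deriveE//.
  exact: det3_lincomb.
(* Differentiability turns the differential of lambda into a directional derivative, which may be
   computed from the local expression y K. *)
have lambda_diff : differentiable (signed_area_density f nu : _ -> R^o) q0.
  exact: differentiable_det3.
rewrite -deriveE// (near_eq_derive _ lambdaE).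
rewrite (derive_val (is_derive := derive_mul_zero y0 y' KC)).
by rewrite !mulf_neq0.
Unshelve. all: by end_near. Qed.

End SignedAreaDensity.

(** * The curvature identity along the singular curve *)

Theorem corollary4p5 (R : realType) (f nu : 'rV[R]_2 -> 'rV[R]_3)
    (gamma eta : R -> 'rV[R]_2) (t0 : R)
    (f_smooth : smooth_near f 0) (f0 : f 0 = 0)
    (f_cuspidal : cuspidal_edge f 0)
    (gamma_param : regular_parametrization_near gamma t0 (singular_set f) 0)
    (nu_normal : unit_normal_near f nu 0)
    (eta_null : null_field_near f gamma eta t0) :
  \forall t \near t0,
    curvature (f \o gamma) t ^+ 2 =
      singular_curvature f nu gamma eta t ^+ 2 +
      limiting_normal_curvature f nu gamma t ^+ 2.
Proof.
have [gamma0 [a [b [V [[abt0 _] gamma_smooth _ _]]]]] := gamma_param.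
have gammaP : \forall t \near (t0 : R^o), differentiable (gamma : R^o -> _) t /\
    forall v : R^o, differentiable ('D_v (gamma : R^o -> _)) t.
  apply: smooth_near_diff; exists `]a, b[%classic; last exact: gamma_smooth.
  by split; [exact: interval_open | rewrite /= in_itv].
have gamma_cvg : gamma t @[t --> t0] --> (0 : 'rV[R]_2).
  rewrite -gamma0; have [dgamma _] := nbhs_singleton gammaP.
  exact: (differentiable_continuous dgamma).
have fP := smooth_near_diff f_smooth.
have [nu_smooth nuP] := nu_normal; have [_ etaP] := eta_null.
have [psi [G factP]] : exists psi G,
    \forall q \near (0 : 'rV[R]_2), cuspidal_factorization psi G f q.
  apply: cuspidal_edge_factorization => //; apply: differentiable_continuous.
  by have [] := nbhs_singleton fP.
near=> t.
(* The germ conditions at [t0] and at 0 are first moved to [t] and [gamma t], where they again hold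
   on neighbourhoods and can be differentiated. *)
have gammat : \forall s \near (t : R^o), differentiable (gamma : R^o -> _) s /\
    forall v : R^o, differentiable ('D_v (gamma : R^o -> _)) s.
  by near: t; exact: (near_join gammaP).
have ft : \forall q \near gamma t,
    differentiable f q /\ forall v, differentiable ('D_v f) q.
  by near: t; exact: (gamma_cvg _ (near_join fP)).
have nut : \forall q \near gamma t,
    enorm (nu q) = 1 /\ forall w, dot ('d f q w) (nu q) = 0.
  by near: t; exact: (gamma_cvg _ (near_join nuP)).
have [dnu _] : differentiable nu (gamma t) /\
    forall v, differentiable ('D_v nu) (gamma t).
  by near: t; exact: (gamma_cvg _ (smooth_near_diff nu_smooth)).
have factt : \forall q \near gamma t, cuspidal_factorization psi G f q.
  by near: t; exact: (gamma_cvg _ (near_join factP)).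
have [etat0 etat _] : [/\ eta t != 0, 'd f (gamma t) (eta t) = 0 &
    0 < det2 (derive1 gamma t) (eta t)] by near: t.
have dft : \forall q \near gamma t, differentiable f q.
  by apply: filterS ft => q [].
have d2ft := (nbhs_singleton ft).2.
have sg1 := diff_signed_area_density_neq0 factt dft d2ft dnu nut etat0 etat.
have [d2c c'E] : derivable (derive1 (f \o gamma)) t 1 /\
    derive1 (f \o gamma) t = 'd f (gamma t) (derive1 gamma t).
  apply: derivable_derive1_comp => //.
    by apply: filterS gammat => s [/derivable1_diffP].
  rewrite (_ : derive1 gamma = 'D_1 gamma); last first.
    by apply/funext => s; rewrite derive1E.
  by apply/derivable1_diffP; exact: (nbhs_singleton gammat).2.
have [nu1 fnu] := nbhs_singleton nut.
have nn : dot (nu (gamma t)) (nu (gamma t)) = 1 by rewrite -enorm_sqr nu1 expr1n.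
have c'nu : dot (derive1 (f \o gamma) t) (nu (gamma t)) = 0 by rewrite c'E.
rewrite (curvature_sqr d2c) /singular_curvature /limiting_normal_curvature.
(* The squared sign is 1 because d lambda(eta) is nonzero, by [sg1]. *)
rewrite /normal_curvature real_normK ?num_real// exprMn sqr_sg sg1 mul1r.
have gram := det3_normal_sqr (derive1n 2 (f \o gamma) t) nn c'nu.
(* The denominators |a|^6 and |a|^4 are rewritten as powers of <a, a>, so that no square root
   remains. *)
rewrite !expr_div_n gram -!exprM mulnC [in X in _ = X + _]exprM enorm_sqr.
rewrite [in X in _ = _ + X](exprM _ 2 2) enorm_sqr.
(* Also valid at [A = 0], i.e. at stationary points of [f \o gamma], as [x / 0 = 0]. *)
have split_sq (A B p q : R) : (A * B - p ^+ 2) / A ^+ 3 =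
    (A * B - p ^+ 2 - A * q ^+ 2) / A ^+ 3 + q ^+ 2 / A ^+ 2.
  have [->|A0] := eqVneq A 0; first by rewrite !expr0n/= !invr0 !mulr0 addr0.
  by field.
exact: split_sq.
Unshelve. all: by end_near. Qed.
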